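(* Let $r\ge2$ and $s\in\{2,3\}$, and let $M$ be chosen from $\underline{M}(s,r,n)$. Then with high probability $M$ has rank (over $GF(2)$) equal to $n-\mathbf{1}_{\{s=2\}}$.
   Context: For integers $r\ge1$, $s\ge2$, $\underline{M}(s,r,n)$ is the random $n\times rn$ matrix over $GF(2)$ in which, for each $i\in[n]$, there are $r$ columns $C_{i,j}$, $j=1,\dots,r$, generated independently; each column $C_{i,j}$ has a unit entry in row $i$ and $s-1$ other unit entries in rows chosen either randomly with replacement from $[n]$ (coinciding unit entries cancel mod 2) or randomly without replacement from $[n]\setminus\{i\}$; all other entries are $0$. ''With high probability'' means with probability $1-o(1)$ as $n\to\infty$. *)

(* Defs.v *)
From mathcomp Require Import all_boot all_order all_algebra.
From mathcomp Require Import all_classical all_reals all_analysis.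

Set Implicit Arguments.
Unset Strict Implicit.
Unset Printing Implicit Defensive.

Import Order.TTheory GRing.Theory Num.Theory.
Import numFieldNormedType.Exports.

Local Open Scope ring_scope.

Inductive sampling := WithReplacement | WithoutReplacement.

(* The rows receiving the [s - 1] other unit entries are recorded in the order
   in which they are drawn. *)
Definition draws (s n : nat) : finType := s.-1.-tuple 'I_n.

(* The sequences of draws that may occur for a column attached to row [i]. *)
Definition admissible (mode : sampling) (s n : nat) (i : 'I_n) :
    {set draws s n} :=
  match mode with
  | WithReplacement => [set: draws s n]
  | WithoutReplacement => [set t : draws s n | uniq t & i \notin t]
  end.

(* Uniform law on [admissible mode s i]. If that set is empty, i.e. without
   replacement and [n < s], this is identically 0 and no such matrix exists. *)
Definition draws_pr (R : realType) (mode : sampling) (s n : nat) (i : 'I_n)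
    (t : draws s n) : R :=
  (t \in admissible mode s i)%:R / #|admissible mode s i|%:R.

(* The sum is taken in GF(2), so coinciding unit entries cancel. *)
Definition column (s n : nat) (i : 'I_n) (t : draws s n) : 'cV['F_2]_n :=
  delta_mx i 0 + \sum_(k <- t) delta_mx k 0.

(* [w (j, i)] holds the draws of the column C_(i,j). *)
Definition outcome (s r n : nat) : finType :=
  {ffun 'I_r * 'I_n -> draws s n}.

(* Columns are generated independently, hence the product. *)
Definition outcome_pr (R : realType) (mode : sampling) (s r n : nat)
    (w : outcome s r n) : R :=
  \prod_(ji : 'I_r * 'I_n) draws_pr R mode ji.2 (w ji).

(* [mxvec] concatenates, for j = 0, ..., r - 1, the blocks
   C_(0,j), ..., C_(n-1,j). *)
Definition random_mx (s r n : nat) (w : outcome s r n) :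
    'M['F_2]_(n, r * n) :=
  \matrix_(k < n)
    mxvec (\matrix_(j < r, i < n) column i (w (j, i)) k 0).

(* Probability that a matrix of the model belongs to [E]. *)
Definition mx_pr (R : realType) (mode : sampling) (s r n : nat)
    (E : pred 'M['F_2]_(n, r * n)) : R :=
  \sum_(w : outcome s r n | E (random_mx w)) outcome_pr R mode w.

(* Main.v *)
(** First moment method on the left kernel. The vector with support [S] kills
    a column iff a parity condition on its draws holds, and which parity depends
    only on whether the column's own row lies in [S]. With uniform draws, if [A]
    and [B] count the draws of either parity and [N = A + B], then [S] is in the
    left kernel for at most [(A ^ l * B ^ (n - l)) ^ r] of the [N ^ (n * r)]
    outcomes, where [l = #|S|]. One term of the binomial expansion of
    [(A + B) ^ n] gives [C(n, l) * A ^ l * B ^ (n - l) <= N ^ n], so the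
    probability is at most [C(n, l) ^ - 2] as soon as [r >= 2]; summing over the
    [C(n, l)] sets of each size [0 < l < n] leaves [\sum_l C(n, l)^-1 = O(1/n)].
    The full support is in the left kernel always if [s] is even, never if [s]
    is odd. Drawing without replacement multiplies the density of an outcome by
    at most [(1 + 6 / n) ^ (r * n) <= e ^ (6 * r)]. *)

Require Import Defs.
From mathcomp Require Import all_boot all_order all_algebra.
From mathcomp Require Import all_classical all_reals all_analysis.
From mathcomp Require Import zify ring lra.
Import Order.TTheory GRing.Theory Num.Theory.
Import numFieldNormedType.Exports.
Local Open Scope ring_scope.

(** * Sums of reciprocal binomial coefficients *)

Lemma bin2M2 n : ('C(n, 2) * 2)%N = (n * n.-1)%N.
Proof. by have := bin_ffact n 2; rewrite ffactnS ffactn1. Qed.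

(** Induction by Pascal's rule: away from the ends [k = 2] and [k = n - 2], both summands of the
    larger coefficient dominate ['C(n, 2)], which in turn is at least ['C(n, 1)]. *)
Lemma leq_bin2 n k : (2 <= k)%N -> (k + 2 <= n)%N -> ('C(n, 2) <= 'C(n, k))%N.
Proof.
elim: n k => [|n IHn] k k2 kn; first lia.
have [->//|k_neq2] := eqVneq k 2%N.
have [k_eq|k_neq] := eqVneq (k + 2)%N n.+1.
  have -> : k = (n.+1 - 2)%N by lia.
  by rewrite bin_sub //; lia.
case: k k2 kn k_neq2 k_neq => // k k2 kn k_neq2 k_neq.
have h1 : ('C(n, 2) <= 'C(n, k.+1))%N by apply: IHn; lia.
have h2 : ('C(n, 2) <= 'C(n, k))%N by apply: IHn; lia.
rewrite [leqRHS]binS [leqLHS]binS bin1.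
rewrite leq_add // (leq_trans _ h2) //.
rewrite -(@leq_pmul2r 2) // bin2M2.
by rewrite leq_mul2l; lia.
Qed.

(** The two end terms are [1 / n] each, and each of the [n - 3] others is at most [1 / 'C(n, 2)], of
    order [1 / n ^ 2]. The constant 8 leaves room for [harmonic n] being [1 / (n + 1)]. *)
Lemma sum_inv_bin_le (R : realType) n : (3 <= n)%N ->
  \sum_(1 <= l < n) ('C(n, l)%:R : R)^-1 <= 8 * harmonic n.
Proof.
case: n => [|[|[|n]]] // _.
rewrite big_ltn // big_nat_recr //= bin1 binSn.
have C2 : ('C(n.+3, 2)%:R : R) = n.+3%:R * n.+2%:R / 2.
  apply: (mulIf (_ : (2 : R) != 0)); first by rewrite pnatr_eq0.
  by rewrite divfK ?pnatr_eq0 // -!natrM bin2M2.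
have mid : \sum_(2 <= l < n.+2) ('C(n.+3, l)%:R : R)^-1 <=
    n%:R * ('C(n.+3, 2)%:R)^-1.
  have -> : n%:R * ('C(n.+3, 2)%:R)^-1 =
      \sum_(2 <= l < n.+2) ('C(n.+3, 2)%:R : R)^-1.
    by rewrite sumr_const_nat subSS subSS subn0 mulr_natl.
  rewrite [leLHS]big_nat [leRHS]big_nat; apply: ler_sum => l /andP[l2 ln].
  have C2gt0 : (0 < 'C(n.+3, 2))%N by rewrite bin_gt0.
  have le_C : ('C(n.+3, 2) <= 'C(n.+3, l))%N by rewrite leq_bin2 //; lia.
  by rewrite lef_pV2 ?posrE ?ltr0n ?ler_nat // (leq_trans C2gt0).
apply: (le_trans (lerD (lexx _) (lerD mid (lexx _)))).
rewrite C2 /harmonic /= -[n.+4]addn4 -[n.+3]addn3 -[n.+2]addn2 !natrD.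
set x : R := n%:R; have x0 : 0 <= x by rewrite ler0n.
rewrite -subr_ge0.
(* Over the common denominator, the difference of the two sides has a numerator with positive
   coefficients. *)
rewrite [leRHS](_ : _ =
    (4 * x ^+ 2 + 20 * x + 32) / ((x + 4) * (x + 3) * (x + 2))).
  by rewrite divr_ge0 // ?mulr_ge0 ?addr_ge0 ?mulr_ge0 ?exprn_ge0.
by field; rewrite !lt0r_neq0 //; lra.
Qed.

(** * Left kernel vectors as sets of rows *)

Definition indicator_row {n : nat} (S : {set 'I_n}) : 'rV['F_2]_n :=
  \row_i (i \in S)%:R.

Lemma indicator_row_support (n : nat) (x : 'rV['F_2]_n) :
  x = indicator_row [set i | x 0 i != 0].
Proof.
apply/rowP => i; rewrite mxE inE.
by case: (x 0 i) => [[|[|//]]] Hm; apply: val_inj.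
Qed.

Lemma natrF2_eq0 (m : nat) : ((m%:R : 'F_2) == 0) = ~~ odd m.
Proof. by rewrite -(dvdn_pcharf (pchar_Fp (isT : prime 2))) dvdn2. Qed.

Lemma indicator_row_mul_column (s n : nat) (S : {set 'I_n}) (i : 'I_n)
    (t : draws s n) :
  (indicator_row S *m column i t) 0 0 = ((i \in S) + count (mem S) t)%:R.
Proof.
rewrite /column mulmxDr mulmx_sumr mxE summxE natrD -colE !mxE; congr (_ + _).
rewrite -sum1_count natr_sum [RHS]big_mkcond /=; apply: eq_bigr => k _.
by rewrite -colE !mxE; case: (k \in S).
Qed.

Lemma left_kernelP (s r n : nat) (S : {set 'I_n}) (w : outcome s r n) :
  reflect (forall ji, (ji.2 \in S) = odd (count (mem S) (w ji)))
          (indicator_row S *m random_mx w == 0).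
Proof.
have entry j i : (indicator_row S *m random_mx w) 0 (mxvec_index j i) =
    ((i \in S) + count (mem S) (w (j, i)))%:R.
  rewrite -indicator_row_mul_column !mxE; apply: eq_bigr => k _.
  by rewrite [random_mx _ _ _]mxE mxvecE mxE.
apply: (iffP eqP) => [Sw0 [j i] /=|Sw].
  move/rowP/(_ (mxvec_index j i)): Sw0; rewrite entry mxE => /eqP.
  by rewrite natrF2_eq0 oddD oddb negb_add => /eqP.
apply/rowP => ji; case/mxvec_indexP: ji => j i; rewrite entry mxE; apply/eqP.
by rewrite natrF2_eq0 oddD oddb negb_add (Sw (j, i)).
Qed.

Definition annihilated (s r : nat) {n : nat} (S : {set 'I_n}) :
    {set outcome s r n} :=
  [set w | indicator_row S *m random_mx w == 0].

Lemma card_annihilated (s r : nat) {n : nat} (S : {set 'I_n}) :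
  ('C(n, #|S|) ^ r * #|annihilated s r S| <= #|outcome s r n|)%N.
Proof.
(* [T true] counts the draws that suit a column whose own row lies in [S], [T false] those that suit
   any other column. *)
pose T b := #|[set t : draws s n | b == odd (count (mem S) t)]|.
have -> : #|annihilated s r S| =
    ((T true ^ #|S| * T false ^ (n - #|S|)) ^ r)%N.
  (* Each condition involves a single column, so the annihilated outcomes form a product set. *)
  transitivity #|family (fun ji : 'I_r * 'I_n =>
      [set t : draws s n | (ji.2 \in S) == odd (count (mem S) t)])|.
    apply: eq_card => w; rewrite inE.
    apply/left_kernelP/familyP => Sw ji.
      by have := Sw ji; rewrite inE => /eqP.
    by have := Sw ji; rewrite inE => /eqP.
  rewrite card_family foldrE big_map big_enum /=.
  rewrite -(pair_bigA _ (fun (j : 'I_r) (i : 'I_n) => T (i \in S))) /=.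
  rewrite prod_nat_const card_ord; congr (_ ^ _)%N.
  rewrite (bigID (mem S)) /=; congr (_ * _)%N.
    by rewrite (eq_bigr (fun=> T true)) ?prod_nat_const // => i ->.
  rewrite (eq_bigr (fun=> T false)) => [|i /negbTE-> //].
  rewrite (eq_bigl (mem (~: S))) => [|i]; last by rewrite !inE.
  by rewrite prod_nat_const cardsCs finset.setCK card_ord.
have cardT : (T false + T true)%N = #|draws s n|.
  rewrite -(cardsC [set t : draws s n | false == odd (count (mem S) t)]).
  by congr addn; apply: eq_card => t; rewrite !inE; case: (odd _).
rewrite card_ffun card_prod !card_ord [(r * n)%N]mulnC expnM -expnMn.
have Sn : (#|S| < n.+1)%N by rewrite ltnS -[leqRHS]card_ord max_card.
have le1 : ('C(n, #|S|) * (T true ^ #|S| * T false ^ (n - #|S|)) <=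
            #|draws s n| ^ n)%N.
  rewrite -cardT expnDn (bigD1 (Ordinal Sn)) //=.
  by rewrite [(T true ^ _ * _)%N]mulnC leq_addr.
by elim: r => // r IHr; rewrite !expnS leq_mul.
Qed.

(** The deterministic part: only the empty and the full support are left for kernel vectors, and the
    parity of [s] decides whether the full one occurs. *)
Lemma rank_random_mx (s r n : nat) (w : outcome s r n) :
  (0 < s)%N -> (0 < r)%N -> (0 < n)%N ->
  (forall S : {set 'I_n}, (0 < #|S| < n)%N ->
     indicator_row S *m random_mx w != 0) ->
  \rank (random_mx w) = (n - ~~ odd s)%N.
Proof.
move=> s0 r0 n0 noker.
(* The all-ones row for even [s] and zero for odd [s], so that [J] spans the left kernel in both
   cases. *)
pose J : 'rV['F_2]_n := const_mx (~~ odd s)%:R.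
have rJ : \rank J = ~~ odd s.
  rewrite rank_rV; congr (nat_of_bool _); rewrite /J.
  case: (odd s) => /=.
    by apply/negbTE; rewrite negbK; apply/eqP/rowP => i; rewrite !mxE.
  apply/eqP => /rowP/(_ (Ordinal n0)); rewrite !mxE => /eqP.
  by rewrite oner_eq0.
have countT (t : draws s n) : odd (count (mem [set: 'I_n]) t) = ~~ odd s.
  rewrite (eq_count (a2 := predT)) => [|k]; last exact: finset.in_setT.
  rewrite count_predT size_tuple; case: s s0 {w noker J rJ t} => //= s.
  by rewrite negbK.
have JE : ~~ odd s -> J = indicator_row [set: 'I_n].
  by move=> os; apply/rowP => i; rewrite !mxE inE os.
have kerJ : (kermx (random_mx w) == J)%MS.
  apply/andP; split; last first.
    apply/sub_kermxP; have [os|os] := boolP (odd s).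
      by rewrite (_ : J = 0) ?mul0mx //; apply/rowP => i; rewrite !mxE os.
    rewrite JE //; apply/eqP/left_kernelP => ji.
    by rewrite countT os inE.
  apply/rV_subP => x /sub_kermxP xM.
  rewrite (indicator_row_support n x) in xM *.
  set S := [set i | _] in xM *.
  have [S0|] := posnP #|S|.
    have -> : indicator_row S = 0.
      by apply/rowP => i; rewrite !mxE (cards0_eq S0) inE.
    exact: sub0mx.
  move=> S0; have ST : S = [set: 'I_n].
    apply/eqP; rewrite eqEcard finset.subsetT cardsT card_ord leqNgt.
    by apply/negP => Sn; have := noker S; rewrite S0 Sn xM eqxx => /(_ isT).
  (* Any one column shows this: its own row and all [s - 1] draws lie in the full support, so
     [s - 1] must be odd. *)
  have ns : ~~ odd s.
    move/eqP/left_kernelP: xM => /(_ (Ordinal r0, Ordinal n0)).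
    by rewrite ST countT inE => <-.
  by rewrite ST JE // submx_refl.
have := eqmx_rank kerJ; rewrite mxrank_ker rJ => <-.
by rewrite subKn // rank_leq_row.
Qed.

(** * Comparison with uniform draws *)

Lemma card_admissible_ge (mode : sampling) (s n : nat) (i : 'I_n) :
  s = 2%N \/ s = 3%N -> (5 <= n)%N ->
  (#|draws s n| * n <= #|admissible mode s i| * (n + 6))%N.
Proof.
move=> hs n5; rewrite card_tuple card_ord.
case: mode => /=.
  by rewrite cardsT card_tuple card_ord leq_mul // leq_addr.
have -> : #|[set t : draws s n | uniq t & i \notin t]| = n.-1 ^_ s.-1.
  rewrite -[n.-1](_ : #|predC1 i| = _); last by rewrite cardC1 card_ord.
  rewrite -card_uniq_tuples; apply: eq_card => t; rewrite !inE andbC.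
  congr andb; rewrite -has_pred1 -all_predC; apply: eq_all => k.
  by rewrite /= eq_sym.
(* For [s = 3] this is [n^3 <= (n-1)(n-2)(n+6)], i.e. [3n^2 - 16n + 12 >= 0], which holds from
   [n = 5] on but fails at [n = 4]. *)
by case: hs => ->; rewrite ?ffactnS ?ffactn0 ?expnS ?expn0; nia.
Qed.

Lemma card_admissible_gt0 (mode : sampling) (s n : nat) (i : 'I_n) :
  s = 2%N \/ s = 3%N -> (5 <= n)%N -> (0 < #|admissible mode s i|)%N.
Proof.
move=> hs n5; have := card_admissible_ge mode _ _ i hs n5.
rewrite card_tuple card_ord; case: posnP => // ->.
by rewrite mul0n leqn0 muln_eq0 expn_eq0; case: n n5 i.
Qed.

Lemma draws_pr_ge0 (R : realType) mode s n (i : 'I_n) (t : draws s n) :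
  0 <= draws_pr R mode i t.
Proof. by rewrite /draws_pr divr_ge0. Qed.

Lemma outcome_pr_ge0 (R : realType) mode s r n (w : outcome s r n) :
  0 <= outcome_pr R mode w.
Proof. by apply: prodr_ge0 => ji _; exact: draws_pr_ge0. Qed.

Lemma outcome_pr_le (R : realType) mode s r n (w : outcome s r n) :
  s = 2%N \/ s = 3%N -> (5 <= n)%N ->
  outcome_pr R mode w <= expR (6 * r%:R) / #|outcome s r n|%:R.
Proof.
move=> hs n5; have n0 : (0 : R) < n%:R by rewrite ltr0n (leq_trans _ n5).
have D0 : (0 : R) < #|draws s n|%:R.
  by rewrite ltr0n card_tuple card_ord expn_gt0 (leq_trans _ n5).
(* The [r * n] factors [expR (6 / n)] multiply to [expR (6 * r)], independent of [n]. *)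
pose c : R := expR (6 / n%:R) / #|draws s n|%:R.
apply: (@le_trans _ _ (\prod_(ji : 'I_r * 'I_n) c)).
  apply: ler_prod => -[j i] _; rewrite draws_pr_ge0 /=.
  have A0 : (0 : R) < #|admissible mode s i|%:R.
    by rewrite ltr0n card_admissible_gt0.
  rewrite /draws_pr; apply: (@le_trans _ _ (#|admissible mode s i|%:R^-1)).
    by rewrite ler_piMl ?invr_ge0 ?(ltW A0) // lern1 leq_b1.
  apply: (@le_trans _ _ ((1 + 6 / n%:R) / #|draws s n|%:R)); last first.
    by rewrite ler_pM2r ?invr_gt0 // expR_ge1Dx.
  rewrite ler_pdivlMr // mulrC ler_pdivrMr //.
  rewrite -(ler_pM2r n0) mulrAC mulrDl mul1r divfK ?lt0r_neq0 //.
  by rewrite [leRHS]mulrC -natrD -!natrM ler_nat card_admissible_ge.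
rewrite prodr_const card_prod !card_ord /c expr_div_n card_ffun card_prod.
rewrite !card_ord natrX ler_pM2r ?invr_gt0 ?exprn_gt0 //.
rewrite -expRM_natl ler_expR natrM.
by rewrite [leLHS](_ : _ = 6 * r%:R) //; field; rewrite lt0r_neq0.
Qed.

Lemma sum_outcome_pr (R : realType) mode s r n :
  s = 2%N \/ s = 3%N -> (5 <= n)%N ->
  \sum_(w : outcome s r n) outcome_pr R mode w = 1.
Proof.
move=> hs n5.
rewrite -(bigA_distr_bigA (fun (ji : 'I_r * 'I_n) t => draws_pr R mode ji.2 t)).
apply: big1 => -[j i] _ /=; rewrite -mulr_suml -natr_sum.
rewrite -big_mkcond /= sum1_card divff // pnatr_eq0 -lt0n.
exact: card_admissible_gt0.
Qed.

(** * Union bound over supports *)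

Lemma mx_pr_rank_ge (R : realType) mode s r n :
  s = 2%N \/ s = 3%N -> (2 <= r)%N -> (5 <= n)%N ->
  1 - expR (6 * r%:R) * (8 * harmonic n) <=
  mx_pr R mode s (fun M : 'M['F_2]_(n, r * n) => \rank M == (n - (s == 2%N))%N).
Proof.
move=> hs hr n5; rewrite /mx_pr lerBlDr.
pose good (w : outcome s r n) := \rank (random_mx w) == (n - (s == 2%N))%N.
(* With 1 written as the total mass, the good outcomes cancel and the mass of the bad ones remains
   to be bounded. *)
rewrite -[leLHS](sum_outcome_pr R mode s r n hs n5).
rewrite (bigID good) /= -/good lerD2l.
pose N : R := #|outcome s r n|%:R.
have N0 : 0 < N.
  rewrite ltr0n card_ffun card_tuple card_ord expn_gt0.
  by rewrite expn_gt0 (leq_trans _ n5).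
apply: (@le_trans _ _ (\sum_(S : {set 'I_n} | (0 < #|S| < n)%N)
          \sum_(w in annihilated s r S) outcome_pr R mode w)).
  (* After the exchange, a bad outcome is counted once for each support annihilating it, hence at
     least once. *)
  rewrite (exchange_big_dep xpredT) //= big_mkcond /=; apply: ler_sum => w _.
  have sum0 P : 0 <= \sum_(S : {set 'I_n} | P S) outcome_pr R mode w.
    by apply: sumr_ge0 => S _; exact: outcome_pr_ge0.
  have [//|bad] := boolP (good w); rewrite /=.
  have [S /andP[Sn Sw]] : exists S : {set 'I_n},
      (0 < #|S| < n)%N && (w \in annihilated s r S).
    apply/existsP; apply: contraR bad => /existsPn noS.
    rewrite /good (rank_random_mx _ _ _ w).
    - by case: hs => ->.
    - by case: hs => ->.
    - exact: ltnW hr.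
    - exact: leq_trans n5.
    by move=> S Sn; have := noS S; rewrite Sn inE.
  by rewrite (bigD1 S) /= ?Sn // lerDl.
apply: (@le_trans _ _ (\sum_(S : {set 'I_n} | (0 < #|S| < n)%N)
          expR (6 * r%:R) * ('C(n, #|S|)%:R ^- 2))).
  apply: ler_sum => S /andP[S0 Sn].
  have C0 : (0 < 'C(n, #|S|))%N by rewrite bin_gt0 ltnW.
  apply: (@le_trans _ _ (\sum_(w in annihilated s r S) expR (6 * r%:R) / N)).
    by apply: ler_sum => w _; exact: outcome_pr_le.
  rewrite sumr_const -[leLHS]mulr_natr -mulrA ler_pM2l ?expR_gt0 //.
  rewrite mulrC ler_pdivrMr //.
  rewrite -ler_pdivrMl ?invr_gt0 ?exprn_gt0 ?ltr0n // invrK.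
  rewrite -natrX -natrM ler_nat (leq_trans _ (card_annihilated s r S)) //.
  by rewrite leq_mul // leq_pexp2l.
rewrite -mulr_sumr ler_pM2l ?expR_gt0 //.
apply: le_trans (sum_inv_bin_le R n _); last exact: leq_trans n5.
(* Group the supports by size; the ['C(n, l)] sets of size [l] cancel one of the two factors
   ['C(n, l)^-1]. *)
rewrite (big_nat_widen 1 n n.+1) // big_geq_mkord.
rewrite (partition_big (fun S : {set 'I_n} => inord #|S| : 'I_n.+1)
          (fun l : 'I_n.+1 => (l < n)%N && (1 <= l)%N)) /=; last first.
  by move=> S /andP[S0 Sn]; rewrite inordK ?Sn // ltnS ltnW.
apply: ler_sum => l /andP[ln l0].
have Cl0 : ('C(n, l)%:R : R) != 0 by rewrite pnatr_eq0 -lt0n bin_gt0 ltnW.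
rewrite (eq_bigl (mem [set S : {set 'I_n} | #|S| == l])) => [|S]; last first.
  have Sn : (#|S| < n.+1)%N by rewrite ltnS -[leqRHS]card_ord max_card.
  rewrite -(inj_eq val_inj) /= inordK // [RHS]inE.
  by case: eqP => [->|_]; rewrite ?andbF ?l0 ?ln.
rewrite (eq_bigr (fun=> 'C(n, l)%:R ^- 2)) => [|S]; last first.
  by rewrite /= inE => /eqP ->.
rewrite sumr_const card_draws card_ord -[leLHS]mulr_natl expr2 invfM mulrA.
by rewrite divff // mul1r.
Qed.

(** * Passage to the limit by squeezing *)

Local Open Scope classical_set_scope.
Local Open Scope ring_scope.

Theorem theorem3 (R : realType) (mode : sampling) (s r : nat)
    (hr : (2 <= r)%N) (hs : s = 2%N \/ s = 3%N) :
  mx_pr R mode s (fun M : 'M['F_2]_(n, r * n) =>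
    \rank M == (n - (s == 2%N))%N) @[n --> \oo] --> (1 : R).
Proof.
pose f n : R := 1 - expR (6 * r%:R) * (8 * harmonic n).
apply: (squeeze_cvgr (f := f) (h := fun=> 1)); last exact: cvg_cst.
  near=> n; have n5 : (5 <= n)%N by near: n; exists 5%N.
  apply/andP; split; first exact: mx_pr_rank_ge.
  rewrite -[leRHS](sum_outcome_pr R mode s r n hs n5) /mx_pr.
  rewrite big_mkcond; apply: ler_sum => w _.
  by case: ifP => // _; exact: outcome_pr_ge0.
suff : f n @[n --> \oo] --> 1 - expR (6 * r%:R) * (8 * 0).
  by rewrite !mulr0 subr0.
apply: cvgB; first exact: cvg_cst.
by apply: cvgMr; apply: cvgMr; exact: cvg_harmonic.
Unshelve. all: by end_near.
Qed.
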